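(* Let $p$ be a prime number whose last decimal digit is $1$. Let $a,b$ be natural numbers such that $p+10=(10a+7)(10b+3)$, and let $x_0$ be a positive rational number such that $p=(10x_0+7)(10b+3)$. Put $A=a+1$ and $X_0=x_0+1$. Then: (1) if $A\ge 31$, then $1<\dfrac{A}{X_0}<\left(1+\dfrac{10}{p}\right)\cdot\dfrac{101}{100}$; (2) if $X_0\ge 3.3$, then $\dfrac{10(p+10)}{11p}<\dfrac{A}{X_0}<\dfrac{101(p+10)}{100p}$. *)

(* Defs.v *)
From mathcomp Require Import all_boot all_order all_algebra.
Set Implicit Arguments.
Unset Strict Implicit.
Unset Printing Implicit Defensive.

(* Main.v *)
(* With D = 10 b + 3, subtracting the two factorisations gives a - x0 = 1 / D,
   so A > X0.  Since (10 A - 3) / (10 X0 - 3) = (p + 10) / p, the ratio A / X0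
   is (p + 10) / p times k = A (10 X0 - 3) / (X0 (10 A - 3)); A > X0 forces
   k < 1, and X0 >= 33 / 10 forces k > 10 / 11. *)
Require Import Defs.
From mathcomp Require Import all_boot all_order all_algebra.
From mathcomp Require Import ring lra.
Import Order.TTheory GRing.Theory Num.Theory.
Local Open Scope ring_scope.

Lemma shifted_factor_gt {F : realFieldType} {P D a x : F} :
  0 < D -> P + 10 = (10 * a + 7) * D -> P = (10 * x + 7) * D -> x < a.
Proof.
move=> D_gt0 factor_a factor_x.
have gapD : (a - x) * D = 1 by move: factor_a; rewrite factor_x; lra.
by rewrite -subr_gt0 -(pmulr_lgt0 _ D_gt0) gapD.
Qed.

(** The ratio already lies below [(P + 10) / P]; the factor [101 / 100] only adds slack. *)
Lemma shifted_ratio_lt {F : realFieldType} {P D a x : F} :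
  0 < D -> 0 < x -> P + 10 = (10 * a + 7) * D -> P = (10 * x + 7) * D ->
  (a + 1) / (x + 1) < 101 * (P + 10) / (100 * P).
Proof.
move=> D_gt0 x_gt0 factor_a factor_x.
have xa := shifted_factor_gt D_gt0 factor_a factor_x.
have P_gt0 : 0 < P by rewrite factor_x mulr_gt0 //; lra.
(* Once both factorisations are substituted, right side minus left side is [3 * (a - x) * D]. *)
have aP_lt : (a + 1) * P < (x + 1) * (P + 10).
  have gapD : 0 < (a - x) * D by rewrite mulr_gt0 ?subr_gt0.
  by rewrite factor_a factor_x; lra.
(* This product is the margin gained in passing from [100] to [101]. *)
have xP_gt0 : 0 < (x + 1) * (P + 10) by apply: mulr_gt0; lra.
rewrite ltr_pdivrMr; last lra.
by rewrite mulrAC ltr_pdivlMr; lra.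
Qed.

Lemma shifted_ratio_gt {F : realFieldType} {P D a x : F} :
  0 < D -> P + 10 = (10 * a + 7) * D -> P = (10 * x + 7) * D ->
  33 / 10 <= x + 1 ->
  10 * (P + 10) / (11 * P) < (a + 1) / (x + 1).
Proof.
move=> D_gt0 factor_a factor_x x_ge.
have xa := shifted_factor_gt D_gt0 factor_a factor_x.
have P_gt0 : 0 < P by rewrite factor_x mulr_gt0 //; lra.
(* With [A = a + 1] and [X = x + 1], this is [11 * A * (10 * X - 3) - 10 * X * (10 * A - 3)]: the
   gap between the cross-multiplied sides, with [D] factored out. Grouped as
   [A * (10 * X - 33) + 30 * X], it shows where the threshold [33 / 10] comes from. *)
have core_gt0 : 0 < 10 * (a + 1) * (x + 1) - 33 * (a + 1) + 30 * (x + 1).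
  have : 0 <= (a + 1) * (10 * (x + 1) - 33) by apply: mulr_ge0; lra.
  by lra.
have coreD_gt0 := mulr_gt0 core_gt0 D_gt0.
rewrite ltr_pdivlMr; last lra.
rewrite mulrAC ltr_pdivrMr; last lra.
by rewrite factor_a factor_x; lra.
Qed.

Theorem theorem3 (p a b : nat) (x0 : rat)
    (p_prime : prime p) (p_last_digit : (p %% 10 = 1)%N)
    (hab : (p + 10 = (10 * a + 7) * (10 * b + 3))%N)
    (x0_gt0 : 0 < x0)
    (hx0 : p%:R = (10 * x0 + 7) * (10 * b%:R + 3) :> rat)
    (A : nat) (hA : A = (a + 1)%N)
    (X0 : rat) (hX0 : X0 = x0 + 1) :
  ((31 <= A)%N ->
     1 < A%:R / X0 /\ A%:R / X0 < (1 + 10 / p%:R) * (101 / 100)) /\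
  (33 / 10 <= X0 ->
     10 * (p%:R + 10) / (11 * p%:R) < A%:R / X0 /\
     A%:R / X0 < 101 * (p%:R + 10) / (100 * p%:R)).
Proof.
have D_gt0 : 0 < 10 * b%:R + 3 :> rat by have := ler0n rat b; lra.
have habQ : p%:R + 10 = (10 * a%:R + 7) * (10 * b%:R + 3) :> rat.
  by rewrite -(natrD _ p 10) hab !(natrM, natrD).
have P_neq0 : p%:R != 0 :> rat by rewrite pnatr_eq0 -lt0n prime_gt0.
(* The upper bounds of (1) and (2) are the same number, so [upper] settles both. *)
have -> : (1 + 10 / p%:R) * (101 / 100)
          = 101 * (p%:R + 10) / (100 * p%:R) :> rat by field.
have upper := shifted_ratio_lt D_gt0 x0_gt0 habQ hx0.
rewrite hA hX0 natrD; split=> [_ | X0_ge]; split=> //.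
- have x0a := shifted_factor_gt D_gt0 habQ hx0.
  by rewrite ltr_pdivlMr; lra.
- exact: shifted_ratio_gt D_gt0 habQ hx0 X0_ge.
Qed.
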